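(* Let $n\ge 3$ and let $r$ be an integer with $0\le r\le n$ and $r\equiv n \pmod 2$. Then $$\sigma_{C_{(n-r)/2,(n+r)/2}}^2<n-1+\frac{r^2}{4}.$$
   Context: For an integer $s$, $C_s=\{A\in\{0,1\}^n:|A|=s\}$, where elements of $\{0,1\}^n$ are identified with subsets of $\{1,\ldots,n\}$; and $C_{r_1,\ldots,r_k}=\bigcup_i C_{r_i}$, equipped with the metric $d(A,B)=|A\triangle B|$ (order of the symmetric difference). For a finite metric space $(\Omega,d)$ with the uniform probability distribution, a function $X:\Omega\to\mathbb{R}$ is Lipschitz if $|X(u)-X(v)|\le d(u,v)$ for all $u,v$, and $\sigma_X^2$ is the smallest $\sigma^2$ such that $\mathbb{E}\,e^{t(X-\mathbb{E}X)}\le e^{\sigma^2t^2/2}$ for all real $t$. The subgaussian constant $\sigma_\Omega^2$ is the supremum of $\sigma_X^2$ over all Lipschitz $X$ on $\Omega$. *)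

(* Defs.v *)
From HB Require Import structures.
From mathcomp Require Import all_boot all_order all_algebra.
From mathcomp Require Import all_classical all_reals all_analysis.

Set Implicit Arguments.
Unset Strict Implicit.
Unset Printing Implicit Defensive.

Import Order.TTheory GRing.Theory Num.Theory.
Local Open Scope classical_set_scope.
Local Open Scope ring_scope.

Record finMetricSpace (R : realType) := FinMetricSpace {
  point :> finType;
  dist : point -> point -> R;
  dist_eq0 : forall u v, dist u v = 0 <-> u = v;
  dist_sym : forall u v, dist u v = dist v u;
  dist_triangle : forall u v w, dist u w <= dist u v + dist v w
}.

Definition unif_mean (R : realType) (T : finType) (X : T -> R) : R :=
  (\sum_(u : T) X u) / #|T|%:R.

Definition lipschitz1 (R : realType) (Om : finMetricSpace R) (X : Om -> R) :
  Prop := forall u v, `|X u - X v| <= dist u v.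

(* [subgaussian_bound X s]: s is an admissible value of sigma^2. *)
Definition subgaussian_bound (R : realType) (T : finType) (X : T -> R) (s : R) :
  Prop :=
  0 <= s /\
  forall t : R, unif_mean (fun u => expR (t * (X u - unif_mean X)))
                <= expR (s * t ^+ 2 / 2).

(* The admissible values form a closed set, so whenever there is one the
   infimum is the smallest of them.  Extended reals avoid the default values
   of [inf] and [sup] on empty or unbounded sets. *)
Definition subgaussian_var (R : realType) (T : finType) (X : T -> R) : \bar R :=
  ereal_inf [set s%:E | s in [set s : R | subgaussian_bound X s]].

Definition subgaussian_const (R : realType) (Om : finMetricSpace R) : \bar R :=
  ereal_sup [set subgaussian_var X | X in [set X : Om -> R | lipschitz1 X]].

Definition symdiff (T : finType) (A B : {set T}) : {set T} :=
  (A :\: B) :|: (B :\: A).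

(* Elements of {0,1}^n are identified with subsets of 'I_n, a copy of {1, ..., n}. *)
Definition slice (n s : nat) : {set {set 'I_n}} :=
  [set A : {set 'I_n} | #|A| == s]%SET.

Definition slices (n : nat) (rs : seq nat) : {set {set 'I_n}} :=
  (\bigcup_(s <- rs) slice n s)%SET.

Section SubsetMetric.
Variables (R : realType) (n : nat) (F : {set {set 'I_n}}).

Definition hamming_dist (A B : {A : {set 'I_n} | A \in F}) : R :=
  #|symdiff (val A) (val B)|%:R.

Lemma hamming_dist_eq0 A B : hamming_dist A B = 0 <-> A = B.
Proof.
rewrite /hamming_dist /symdiff; split=> [/eqP|->]; last first.
  by rewrite finset.setDv finset.setU0 cards0.
rewrite pnatr_eq0 cards_eq0 finset.setU_eq0 !finset.setD_eq0 => /andP[AB BA].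
by apply/val_inj/eqP; rewrite finset.eqEsubset AB.
Qed.

Lemma hamming_dist_sym A B : hamming_dist A B = hamming_dist B A.
Proof. by rewrite /hamming_dist /symdiff finset.setUC. Qed.

Lemma hamming_dist_triangle A B C :
  hamming_dist A C <= hamming_dist A B + hamming_dist B C.
Proof.
rewrite /hamming_dist -natrD ler_nat.
apply: leq_trans (leq_card_setU _ _); apply/subset_leq_card/fintype.subsetP => x.
rewrite !inE.
by case: (x \in val A); case: (x \in val B); case: (x \in val C).
Qed.

Definition hamming_space : finMetricSpace R :=
  FinMetricSpace hamming_dist_eq0 hamming_dist_sym hamming_dist_triangle.

End SubsetMetric.

(* Main.v *)
Require Import Defs.
From mathcomp Require Import all_boot all_order all_algebra.
From mathcomp Require Import all_classical all_reals all_analysis.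
From mathcomp Require Import ring lra zify.

(* Conditionally on the level, the set is uniform on one slice. Revealing its
   elements one at a time gives a martingale with at most n - 1 nontrivial
   steps; each step is a two-point variable whose values differ by at most 2
   (exchange two elements), so Hoeffding's lemma bounds the subgaussian constant
   of a slice by n - 1. A two-point variable with weights p and 1 - p, p <> 1/2,
   satisfies a strictly better bound, and the first or the second step is
   asymmetric, whence a strict inequality uniform in the Lipschitz function.
   Coupling the two levels by inclusion, the level means differ by at most r,
   and the symmetric mixture adds at most r^2/4. *)

Set Implicit Arguments.
Unset Strict Implicit.
Unset Printing Implicit Defensive.

Import Order.TTheory GRing.Theory Num.Theory.
Import numFieldNormedType.Exports.
Local Open Scope ring_scope.

(** * Hyperbolic functions and a Gaussian bound for [cosh] *)

Definition sinh (R : realType) (x : R) : R := (expR x - expR (- x)) / 2.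
Definition cosh (R : realType) (x : R) : R := (expR x + expR (- x)) / 2.

Section Hyperbolic.
Variable R : realType.
Implicit Types x y w : R.

Lemma MVT_is_derive {f df : R -> R} {a b : R} :
  a < b -> (forall x, is_derive x 1 f (df x)) ->
  exists c, [/\ a < c, c < b & f b - f a = df c * (b - a)].
Proof.
move=> ab fdf; have [c|c] := @MVT R f df a b ab (fun x _ => fdf x).
  by apply: derivable_within_continuous => x _; apply: ex_derive.
by rewrite in_itv => /andP[ac cb] E; exists c.
Qed.

Lemma ge0_is_derive_le {f df : R -> R} {a b : R} :
  a <= b -> (forall x, is_derive x 1 f (df x)) ->
  (forall x, a <= x <= b -> 0 <= df x) -> f a <= f b.
Proof.
rewrite le_eqVlt => /predU1P[->//|ab] fdf df0.
have [c [ac cb E]] := MVT_is_derive ab fdf.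
by rewrite -subr_ge0 E mulr_ge0 ?subr_ge0 ?df0 // ltW //= ltW.
Qed.

Global Instance is_derive_sinh x : is_derive x (1 : R) (@sinh R) (cosh x).
Proof.
rewrite /cosh.
have -> : @sinh R = 2^-1 \*: (expR - (expR \o -%R)) :> (R -> R).
  by apply/funext => y; rewrite /sinh mulrC.
apply: is_derive_eq.
rewrite /GRing.scale /=; ring.
Qed.

Global Instance is_derive_cosh x : is_derive x (1 : R) (@cosh R) (sinh x).
Proof.
rewrite /sinh.
have -> : @cosh R = 2^-1 \*: (expR + (expR \o -%R)) :> (R -> R).
  by apply/funext => y; rewrite /cosh mulrC.
apply: is_derive_eq.
rewrite /GRing.scale /=; ring.
Qed.

Lemma sinhD x y : sinh (x + y) = sinh x * cosh y + cosh x * sinh y.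
Proof. by rewrite /sinh /cosh opprD !expRD; field. Qed.

Lemma sinhN x : sinh (- x) = - sinh x.
Proof. by rewrite /sinh opprK -mulNr opprB. Qed.

Lemma coshN x : cosh (- x) = cosh x.
Proof. by rewrite /cosh opprK addrC. Qed.

Lemma sinh0 : sinh 0 = 0 :> R.
Proof. by rewrite /sinh oppr0 subrr mul0r. Qed.

Lemma cosh_gt0 x : 0 < cosh x.
Proof. by rewrite divr_gt0 // addr_gt0 // expR_gt0. Qed.

Lemma sinh_ge0 x : 0 <= x -> 0 <= sinh x.
Proof. by move=> x0; rewrite divr_ge0 // subr_ge0 ler_expR; lra. Qed.

Lemma sinh_gt0 x : 0 < x -> 0 < sinh x.
Proof. by move=> x0; rewrite divr_gt0 // subr_gt0 ltr_expR; lra. Qed.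

Lemma cosh_le x y : 0 <= x -> x <= y -> cosh x <= cosh y.
Proof.
move=> x0 xy; apply: (ge0_is_derive_le xy (@is_derive_cosh)) => z /andP[xz _].
exact/sinh_ge0/(le_trans x0).
Qed.

(** The difference of the two sides vanishes at 0 and has derivative [z * sinh z], positive for
    [z > 0]. *)
Lemma sinh_lt_mul_cosh x : 0 < x -> sinh x < x * cosh x.
Proof.
move=> x0.
have D z : is_derive z (1 : R) (id * @cosh R - @sinh R) (z * sinh z).
  by apply: is_derive_eq; rewrite /GRing.scale /=; ring.
have [c [c0 _]] := MVT_is_derive x0 D.
rewrite !fctE sinh0 mul0r !subr0 => E.
by rewrite -subr_gt0 E; do 2?apply: mulr_gt0 => //; exact: sinh_gt0.
Qed.

(** As a function of [z], [x * sinh z - z * sinh x] vanishes at [z = x], and beyond [x] its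
    derivative is at least [x * cosh x - sinh x], which is positive. *)
Lemma sinh_convex x y : 0 < x -> x <= y -> y * sinh x <= x * sinh y.
Proof.
move=> x0 xy.
have D z : is_derive z (1 : R) (x \*: @sinh R - sinh x \*: id) (x * cosh z - sinh x).
  by apply: is_derive_eq; rewrite /GRing.scale /=; ring.
suff : x * sinh x - sinh x * x <= x * sinh y - sinh x * y by nra.
apply: (ge0_is_derive_le xy D) => z /andP[xz _].
rewrite subr_ge0 (le_trans (ltW (sinh_lt_mul_cosh x0))) // ler_wpM2l ?(ltW x0) //.
by rewrite cosh_le // (ltW x0).
Qed.

(* Product formulas turn the claim into convexity of [sinh] at [y - x] and [y + x]. *)
Lemma mul_coth_le x y : 0 <= x -> x <= y ->
  x * cosh x * sinh y <= y * cosh y * sinh x.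
Proof.
move=> x0; rewrite le_eqVlt => /predU1P[->//|xy].
have := @sinh_convex (y - x) (y + x) _ _.
rewrite subr_gt0 xy => /(_ isT); have -> : y - x <= y + x by lra.
move=> /(_ isT); rewrite !sinhD sinhN coshN; lra.
Qed.

(** The derivative of [cosh w * expR (- (k * w ^+ 2 / 2))] has the sign of
    [sinh w - k * w * cosh w], so this function increases up to [x] and decreases afterwards. *)
Lemma cosh_gauss_le (k x y : R) :
  (forall w, 0 <= w -> w <= x -> k * w * cosh w <= sinh w) ->
  (forall w, x <= w -> sinh w <= k * w * cosh w) ->
  0 <= x -> 0 <= y ->
  cosh y * expR (- (k * y ^+ 2 / 2)) <= cosh x * expR (- (k * x ^+ 2 / 2)).
Proof.
move=> below above x0 y0.
pose f := (@cosh R * (expR \o ((- (k / 2)) \*: (id * id)))).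
have fE z : cosh z * expR (- (k * z ^+ 2 / 2)) = f z.
  rewrite /f !fctE /=; congr (_ * expR _).
  by transitivity (- (k / 2) * (z * z)); first field.
have D z :
    is_derive z (1 : R) f ((sinh z - k * z * cosh z) * expR (- (k * z ^+ 2 / 2))).
  rewrite /f; apply: is_derive_eq; rewrite /GRing.scale /= !fctE.
  rewrite -[_ *: (z * z)]/(- (k / 2) * (z * z)).
  have -> : - (k / 2) * (z * z) = - (k * z ^+ 2 / 2) by field.
  by rewrite /=; field.
rewrite !fE; have [yx|xy] := leP y x.
  apply: (ge0_is_derive_le yx D) => z /andP[yz zx].
  by rewrite mulr_ge0 ?expR_ge0 // subr_ge0 below // (le_trans y0).
rewrite -lerN2.
apply: (@ge0_is_derive_le (- f) _ x y (ltW xy) (fun z => is_deriveN (D z))).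
move=> z /andP[xz _]; rewrite -mulNr mulr_ge0 ?expR_ge0 // opprB subr_ge0.
exact: above.
Qed.

(* [ln (cosh y)] is concave as a function of [y ^+ 2]; [k] is twice the slope of
   its tangent at [x ^+ 2], that is [tanh x / x], or [1] at [x = 0]. *)
Lemma cosh_quadratic_le (x : R) : exists k : R, [/\ 0 <= k, k <= 1,
  (x != 0 -> k < 1), k * x * cosh x = sinh x &
  forall y, cosh y <= cosh x * expR (k * (y ^+ 2 - x ^+ 2) / 2)].
Proof.
wlog x0 : x / 0 <= x.
  move=> H; have [/H//|/ltW] := leP 0 x.
  rewrite -oppr_ge0 => /H[k [k0 k1 k1' kx B]]; exists k; split => //.
  - by rewrite -oppr_eq0.
  - by move: kx; rewrite sinhN coshN mulrN mulNr => /oppr_inj.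
  - by move=> y; rewrite -(coshN x) -(sqrrN x).
suff [k [k0 k1 k1' kx B]] : exists k : R, [/\ 0 <= k, k <= 1,
    (x != 0 -> k < 1), k * x * cosh x = sinh x & forall y, 0 <= y ->
  cosh y * expR (- (k * y ^+ 2 / 2)) <= cosh x * expR (- (k * x ^+ 2 / 2))].
  exists k; split => // y.
  have -> : cosh y = cosh `|y| by case: (ger0P y) => // _; rewrite coshN.
  have -> : k * (y ^+ 2 - x ^+ 2) / 2
     = - (k * x ^+ 2 / 2) + k * `|y| ^+ 2 / 2 by rewrite real_normK ?num_real //; ring.
  by rewrite expRD mulrA -ler_pdivrMr ?expR_gt0 // -expRN B.
move: x0; rewrite le_eqVlt => /predU1P[<-|x0].
  (* At [x = 0] the condition below [x] concerns only [w = 0], and the one above is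
     [sinh w <= w * cosh w]. *)
  exists 1; rewrite eqxx mulr0 mul0r sinh0; split => // y y0.
  apply: cosh_gauss_le => // w w0.
    by move=> w0'; rewrite (_ : w = 0) ?mulr0 ?mul0r ?sinh0 //; lra.
  move: w0; rewrite le_eqVlt mul1r => /predU1P[<-|/sinh_lt_mul_cosh/ltW//].
  by rewrite sinh0 mul0r.
have xc0 : 0 < x * cosh x by rewrite mulr_gt0 ?cosh_gt0.
have xs := sinh_lt_mul_cosh x0.
exists (sinh x / (x * cosh x)).
have k1 : sinh x / (x * cosh x) < 1 by rewrite ltr_pdivrMr // mul1r.
split => //; first by apply: divr_ge0; [exact/sinh_ge0/ltW|exact: ltW].
- exact: ltW.
- by rewrite -mulrA divfK ?gt_eqF.
move=> y y0; apply: cosh_gauss_le (ltW x0) y0 => w.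
  move=> w0 wx; rewrite -mulrA mulrAC ler_pdivrMr // mulrC [_ * (x * _)]mulrC.
  exact: mul_coth_le.
move=> xw; rewrite -mulrA mulrAC ler_pdivlMr // mulrC [sinh x * _]mulrC.
by apply: mul_coth_le => //; exact: ltW.
Qed.

End Hyperbolic.

(** * Two-point variables *)

(** The left-hand side is the moment generating function of a centred Bernoulli variable of
    parameter [p]; [k = 1] is Hoeffding's bound. *)
Definition two_point_bound (R : realType) (p k : R) := forall u,
  (1 - p) * expR (- (p * u)) + p * expR ((1 - p) * u) <= expR (k * u ^+ 2 / 8).

(* Hoeffding's lemma for two-point variables, with the strict improvement of
   Kearns and Saul off the symmetric case. *)
Lemma two_point_subgaussian (R : realType) (p : R) : 0 <= p <= 1 ->
  exists k : R, [/\ 0 <= k, k <= 1, (p != 2^-1 -> k < 1) & two_point_bound p k].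
Proof.
move=> /andP[p0 p1].
have [->|p_neq0] := eqVneq p 0.
  exists 0; split => // u; rewrite !(mul0r, oppr0, subr0, addr0) expR0; lra.
have [->|p_neq1] := eqVneq p 1.
  exists 0; split => // u; rewrite subrr !(mul0r, mul1r, add0r) expR0; lra.
have {}p0 : 0 < p by lra.
have {}p1 : 0 < 1 - p by lra.
(* With [x] half the log-odds, the weights are [exp (-x)] and [exp x] over
   [2 cosh x], so the left-hand side is [cosh (u / 2 - x) / cosh x] up to an
   exponential factor. *)
pose x := ln ((1 - p) / p) / 2.
have e2x : expR x * expR x = (1 - p) / p.
  by rewrite -expRD /x -splitr lnK // posrE divr_gt0.
have e0 := expR_gt0 x.
have eN : expR (- x) = (expR x)^-1 by rewrite expRN.
have c0 := cosh_gt0 x.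
have pE : p = expR (- x) / (2 * cosh x).
  rewrite /cosh eN; have -> : p = (1 + expR x * expR x)^-1.
    by rewrite e2x; field; lra.
  field; nra.
have qE : 1 - p = expR x / (2 * cosh x).
  rewrite pE {1}/cosh /cosh eN; field; nra.
have [k [k0 k1 k1' kx B]] := cosh_quadratic_le x.
exists k; split => //.
  move=> p2; apply: k1'; apply: contra p2 => /eqP x0; apply/eqP.
  move: e2x; rewrite x0 expR0 => /(congr1 ( *%R^~ p)).
  by rewrite divfK ?gt_eqF //; lra.
move=> u; have := B (u / 2 - x).
(* The midpoint of the two exponents; since [k * x = 1 - 2 * p], it is also the linear term
   [k * x * u / 2] of the quadratic bound. *)
pose v := (1 - 2 * p) * u / 2.
have kxp : k * x = 1 - 2 * p.
  have -> : k * x = sinh x / cosh x by rewrite -kx mulfK // gt_eqF.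
  have -> : 1 - 2 * p = (1 - p) - p by ring.
  by rewrite qE pE /sinh; field; lra.
have -> : k * ((u / 2 - x) ^+ 2 - x ^+ 2) / 2 = k * u ^+ 2 / 8 - k * x * u / 2.
  by field.
rewrite kxp -/v.
rewrite expRB mulrA ler_pdivlMr ?expR_gt0 // mulrC -ler_pdivrMl // => /(le_trans _).
apply.
have -> : - (p * u) = v - u / 2 by rewrite /v; field.
have -> : (1 - p) * u = v + u / 2 by rewrite /v; field.
rewrite qE pE [cosh (_ - x)]/cosh opprB !expRB !expRD expRN.
have eu := expR_gt0 (u / 2); rewrite le_eqVlt; apply/orP; left; apply/eqP.
field; lra.
Qed.

(** * Averages over finite sets and mixtures *)

Section Average.
Variables (R : realType) (T : finType).
Implicit Types (D E : {set T}) (X : T -> R) (s : R).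

Definition avg D X : R := (\sum_(a in D) X a) / #|D|%:R.

Definition subgaussian_on D X s := forall t,
  avg D (fun a => expR (t * (X a - avg D X))) <= expR (s * t ^+ 2 / 2).

Lemma avgZ D c X : avg D (fun a => c * X a) = c * avg D X.
Proof. by rewrite /avg -mulr_sumr mulrA. Qed.

Lemma avg_setU D E X : [disjoint D & E] -> (0 < #|D|)%N -> (0 < #|E|)%N ->
  let p := #|E|%:R / #|D :|: E|%:R in
  avg (D :|: E) X = (1 - p) * avg D X + p * avg E X.
Proof.
move=> DE D0 E0 p; rewrite /avg /p (_ : \sum_(a in _ :|: _) X a =
    \sum_(a in D) X a + \sum_(a in E) X a); last first.
  by rewrite -bigU //; apply: eq_bigl => a; rewrite !inE.
rewrite finset.cardsU finset.disjoint_setI0 // cards0 subn0 natrD.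
by field; rewrite -natrD !pnatr_eq0; lia.
Qed.

Lemma subgaussian_on_le D X s1 s2 :
  s1 <= s2 -> subgaussian_on D X s1 -> subgaussian_on D X s2.
Proof.
move=> s12 H t; apply: le_trans (H t) _.
by rewrite ler_expR ler_pM2r // ler_wpM2r // sqr_ge0.
Qed.

(** [X] equals its mean on a singleton, and averages over the empty set are 0. *)
Lemma subgaussian_on_card_le1 D X s :
  (#|D| <= 1)%N -> 0 <= s -> subgaussian_on D X s.
Proof.
move=> D1 s0 t; apply: (@le_trans _ _ 1); last first.
  by rewrite -expR0 ler_expR divr_ge0 // mulr_ge0 // sqr_ge0.
have [->|[a ->]] : D = finset.set0 \/ exists a, D = [set a].
  case: (posnP #|D|) => [/eqP|D0]; first by rewrite cards_eq0 => /eqP; left.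
  by right; apply/cards1P/eqP; lia.
  by rewrite /avg big_set0 mul0r.
by rewrite /avg !big_set1 cards1 !divr1 subrr mulr0 expR0.
Qed.

(** Conditioning on the part: the deviation is the one inside the part plus a two-point variable
    given by the part means, whose gap is at most [d]. *)
Lemma subgaussian_on_setU D E X (k d s : R) :
  [disjoint D & E] -> (0 < #|D|)%N -> (0 < #|E|)%N ->
  two_point_bound (#|E|%:R / #|D :|: E|%:R) k -> 0 <= k ->
  `|avg D X - avg E X| <= d ->
  subgaussian_on D X s -> subgaussian_on E X s ->
  subgaussian_on (D :|: E) X (s + k * d ^+ 2 / 4).
Proof.
move=> DE D0 E0; set p := _ / _ => kP k0 dP HD HE t.
set m := avg (D :|: E) X.
have mE : m = (1 - p) * avg D X + p * avg E X by exact: avg_setU.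
have p01 : 0 <= p <= 1.
  rewrite divr_ge0 //= ler_pdivrMr ?mul1r ?ltr0n ?ler_nat.
    by rewrite subset_leq_card // finset.subsetUr.
  by rewrite (leq_trans D0) // subset_leq_card // finset.subsetUl.
(* Recentring at the mean of the part splits off the factor that belongs to the two-point
   variable. *)
have shift F : avg F (fun a => expR (t * (X a - m))) =
    expR (t * (avg F X - m)) * avg F (fun a => expR (t * (X a - avg F X))).
  rewrite -avgZ; congr (_ / _); apply: eq_bigr => a _.
  by rewrite -expRD; congr expR; ring.
rewrite avg_setU // -/p !shift.
pose u := t * (avg E X - avg D X).
have -> : t * (avg D X - m) = - (p * u) by rewrite mE /u; ring.
have -> : t * (avg E X - m) = (1 - p) * u by rewrite mE /u; ring.
have u2 : k * u ^+ 2 / 8 <= k * d ^+ 2 / 4 * t ^+ 2 / 2.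
  have : (avg E X - avg D X) ^+ 2 <= d ^+ 2.
    rewrite -sqrrN opprB -[leLHS]real_normK ?num_real //.
    by rewrite lerXn2r // nnegrE ?(le_trans _ dP).
  rewrite /u exprMn => /(ler_wpM2l (sqr_ge0 t)) /(ler_wpM2l k0); lra.
have -> : (s + k * d ^+ 2 / 4) * t ^+ 2 / 2
  = k * d ^+ 2 / 4 * t ^+ 2 / 2 + s * t ^+ 2 / 2 by field.
rewrite expRD.
apply: (@le_trans _ _ (expR (k * u ^+ 2 / 8) * expR (s * t ^+ 2 / 2))); last first.
  by rewrite ler_pM2r ?expR_gt0 // ler_expR.
apply: le_trans (ler_wpM2r (expR_ge0 _) (kP u)).
rewrite [leRHS]mulrDl; apply: lerD; rewrite [leLHS]mulrA.
  by apply: ler_wpM2l => //; rewrite mulr_ge0 ?expR_ge0 //; lra.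
by apply: ler_wpM2l => //; rewrite mulr_ge0 ?expR_ge0 //; lra.
Qed.

(* Averaging [f a - g b] over the pairs related by a biregular relation. *)
Lemma avg_dist_biregular D E (r : rel T) (p q : nat) (f g : T -> R) c :
  (0 < #|D|)%N -> (0 < p)%N -> (0 < q)%N ->
  (forall a, a \in D -> #|[set b in E | r a b]%SET| = p) ->
  (forall b, b \in E -> #|[set a in D | r a b]%SET| = q) ->
  (forall a b, a \in D -> b \in E -> r a b -> `|f a - g b| <= c) ->
  `|avg D f - avg E g| <= c.
Proof.
move=> D0 p0 q0 rp rq fg.
have count (h : T -> T -> R) : 
    \sum_(a in D) \sum_(b in E | r a b) h a b =
    \sum_(b in E) \sum_(a in D | r a b) h a b.
  rewrite (exchange_big_dep (mem E)) /= => [|a b _ /andP[]//].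
  by apply: eq_bigr => b bE; apply: eq_bigl => a; rewrite bE.
have sumD (h : T -> R) :
    \sum_(a in D) \sum_(b in E | r a b) h a = p%:R * \sum_(a in D) h a.
  rewrite mulr_sumr; apply: eq_bigr => a aD; rewrite -(rp a aD) mulr_natl -sumr_const.
  by apply: eq_bigl => b; rewrite inE.
have sumE (h : T -> R) :
    \sum_(a in D) \sum_(b in E | r a b) h b = q%:R * \sum_(b in E) h b.
  rewrite (count (fun=> h)) mulr_sumr; apply: eq_bigr => b bE.
  rewrite -(rq b bE) mulr_natl -sumr_const.
  by apply: eq_bigl => a; rewrite inE.
(* Double counting of the related pairs. *)
have pq : p%:R * #|D|%:R = q%:R * #|E|%:R :> R.
  by have := sumD (fun=> 1); rewrite (sumE (fun=> 1)) !sumr_const.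
have pD : 0 < p%:R * #|D|%:R :> R by rewrite mulr_gt0 ?ltr0n.
have E0 : 0 < #|E|%:R :> R by move: pD; rewrite pq pmulr_rgt0 ?ltr0n.
have -> : avg D f - avg E g =
    (\sum_(a in D) \sum_(b in E | r a b) (f a - g b)) / (p%:R * #|D|%:R).
  under eq_bigr do rewrite sumrB; rewrite sumrB sumD sumE mulrBl {2}pq /avg.
  by congr (_ - _); field; rewrite ?(gt_eqF E0) !pnatr_eq0; lia.
rewrite normrM normfV (gtr0_norm pD) ler_pdivrMr //.
apply: le_trans (ler_norm_sum _ _ _) _.
rewrite mulrCA [c * _]mulrC [#|D|%:R * c]mulr_natl -sumr_const -(sumD (fun=> c)).
apply: ler_sum => a aD; apply: le_trans (ler_norm_sum _ _ _) _.
by apply: ler_sum => b /andP[bE rab]; exact: fg.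
Qed.

End Average.

Lemma subgaussian_on_imset (R : realType) (T U : finType) (h : T -> U)
    (D : {set T}) (X : U -> R) s : {in D &, injective h} ->
  subgaussian_on (h @: D) X s <-> subgaussian_on D (X \o h) s.
Proof.
move=> hI; have E Y : avg (h @: D) Y = avg D (Y \o h).
  by rewrite /avg big_imset // card_in_imset.
by split=> H t; have := H t; rewrite !E.
Qed.

(** * Slices of a finite set *)

Section Slice.
Variables (R : realType) (T : finType).
Implicit Types (S A B : {set T}) (X : {set T} -> R).

Definition slice_of S (k : nat) := [set A : {set T} | A \subset S & #|A| == k]%SET.

(** Inclusion between two levels is biregular, so the means can be compared along nested pairs. *)
Lemma avg_dist_slice S (k c : nat) (f g : {set T} -> R) (d : R) :
  (k + c <= #|S|)%N ->
  (forall A B, A \in slice_of S (k + c)%N -> B \in slice_of S k -> B \subset A ->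
    `|f A - g B| <= d) ->
  `|avg (slice_of S (k + c)%N) f - avg (slice_of S k) g| <= d.
Proof.
move=> kc fg.
apply: (@avg_dist_biregular _ _ _ _ (fun A B => B \subset A)
  'C(k + c, k)%N 'C(#|S| - k, c)%N) => //;
  rewrite ?bin_gt0 ?cards_draws ?bin_gt0 ?leq_addr //.
- lia.
- move=> A; rewrite inE => /andP[AS /eqP <-]; rewrite -cards_draws.
  apply: eq_card => B; rewrite !inE andbC; have [BA|] := boolP (B \subset A) => //.
  by rewrite (fintype.subset_trans BA AS).
- move=> B; rewrite inE => /andP[BS /eqP kE].
  (* The supersets [A] of [B] are counted through [A :\: B], a subset of [S :\: B] of size [c]. *)
  have -> : (#|S| - k)%N = #|S :\: B|.
    by rewrite finset.cardsD (finset.setIidPr BS) kE.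
  rewrite -cards_draws -[RHS](@card_in_imset _ _ (fun C => B :|: C)); last first.
    move=> C1 C2; rewrite !inE !finset.subsetD.
    move=> /andP[/andP[_ d1] _] /andP[/andP[_ d2] _] E.
    have dE (C : {set T}) : [disjoint C & B] -> C = (B :|: C) :\: B.
      move=> dCB; rewrite finset.setDUl finset.setDv finset.set0U.
      by apply/esym/finset.setDidPl.
    by rewrite (dE C1 d1) E -dE.
  apply: eq_card => A; rewrite !inE; apply/idP/imsetP.
    move=> /andP[/andP[AS /eqP Ac] BA]; exists (A :\: B).
      rewrite inE finset.setSD // finset.cardsD (finset.setIidPr BA) kE Ac.
      by rewrite addKn eqxx.
    by rewrite -{1}(finset.setID A B) (finset.setIidPr BA).
  case=> C; rewrite inE finset.subsetD => /andP[/andP[CS dCB] /eqP Cc] ->.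
  rewrite finset.subUset BS CS finset.subsetUl finset.cardsU kE Cc.
  by rewrite finset.setIC finset.disjoint_setI0 // cards0 subn0 eqxx.
Qed.

(** The set form of Pascal's rule. *)
Lemma slice_of_setD1 S x k : x \in S ->
  slice_of S k.+1 =
    slice_of (S :\ x) k.+1 :|: (fun A => x |: A) @: slice_of (S :\ x) k.
Proof.
move=> xS; apply/setP => A; rewrite !inE finset.subsetD1.
have [xA|xA] := boolP (x \in A); last first.
  rewrite andbT orbC; case: imsetP => // -[B _ AE].
  by move: xA; rewrite AE !inE eqxx.
rewrite andbF /=; apply/andP/imsetP.
  move=> [AS /eqP Ac]; exists (A :\ x); last by rewrite finset.setD1K.
  by rewrite inE finset.setSD //=; have := cardsD1 x A; rewrite xA Ac; lia.
case=> B; rewrite inE finset.subsetD1 => /andP[/andP[BS xB] /eqP Bc] ->.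
by rewrite finset.subUset finset.sub1set xS BS cardsU1 xB Bc.
Qed.

Lemma setU1_inj_slice S x k :
  {in slice_of (S :\ x) k &, injective (fun A => x |: A)}.
Proof.
move=> A B; rewrite !inE !finset.subsetD1 => /andP[/andP[_ xA] _] /andP[/andP[_ xB] _] E.
by rewrite -(finset.setU1K xA) E finset.setU1K.
Qed.

(** The Lipschitz condition for one exchange within a single level; both branches inherit it when an
    element is revealed. *)
Definition swap_lipschitz S k X := forall B y z,
  B \subset S -> #|B|.+1 = k -> y \in S :\: B -> z \in S :\: B ->
  `|X (y |: B) - X (z |: B)| <= 2.

Lemma swap_lipschitz_out S x k X :
  swap_lipschitz S k X -> swap_lipschitz (S :\ x) k X.
Proof.
move=> H B y z BS Bk; rewrite !inE => /and3P[yB _ yS] /and3P[zB _ zS].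
by apply: H; rewrite ?inE ?yB ?zB //; move: BS; rewrite finset.subsetD1 => /andP[].
Qed.

Lemma swap_lipschitz_in S x k X : x \in S ->
  swap_lipschitz S k.+1 X -> swap_lipschitz (S :\ x) k (fun A => X (x |: A)).
Proof.
move=> xS H B y z; rewrite finset.subsetD1 => /andP[BS xB] Bk.
rewrite !inE => /and3P[yB yx yS] /and3P[zB zx zS].
rewrite !(finset.setUCA [set x]%SET); apply: H.
- by rewrite finset.subUset finset.sub1set xS.
- by rewrite cardsU1 xB -Bk.
- by rewrite !inE negb_or yx yB.
- by rewrite !inE negb_or zx zB.
Qed.

Lemma subgaussian_on_slice_trivial S k X s :
  (k == 0%N) || (#|S| <= k)%N -> 0 <= s -> subgaussian_on (slice_of S k) X s.
Proof.
move=> kS; apply: subgaussian_on_card_le1; rewrite cards_draws.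
case/orP: kS => [/eqP->|]; first by rewrite bin0.
by rewrite leq_eqVlt => /predU1P[->|/bin_small->//]; rewrite binn.
Qed.

(* Revealing whether [x] belongs to the random set: the two conditional means
   differ by at most 2, by exchanging [x] with another element. *)
Lemma subgaussian_on_slice_step S x k X (kappa s : R) :
  x \in S -> (k.+1 < #|S|)%N ->
  two_point_bound (k.+1%:R / #|S|%:R) kappa -> 0 <= kappa ->
  swap_lipschitz S k.+1 X ->
  subgaussian_on (slice_of (S :\ x) k.+1) X s ->
  subgaussian_on (slice_of (S :\ x) k) (fun A => X (x |: A)) s ->
  subgaussian_on (slice_of S k.+1) X (s + kappa).
Proof.
move=> xS kS kP k0 HX H0 H1.
have Sx : #|S| = #|S :\ x|.+1 by rewrite (cardsD1 x) xS.
have inj := @setU1_inj_slice S x k.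
have -> : s + kappa = s + kappa * 2 ^+ 2 / 4 by field.
rewrite (slice_of_setD1 k xS); apply: subgaussian_on_setU => //.
- rewrite disjoint_subset; apply/fintype.subsetP => A.
  rewrite !inE finset.subsetD1 => /andP[/andP[_ xA] _].
  by apply: contra xA => /imsetP[B _ ->]; rewrite !inE eqxx.
- by rewrite cards_draws bin_gt0; lia.
- by rewrite card_in_imset // cards_draws bin_gt0; lia.
- rewrite -(slice_of_setD1 k xS) card_in_imset // !cards_draws.
  (* The probability that the random set contains [x]. *)
  suff -> : 'C(#|S :\ x|, k)%:R / 'C(#|S|, k.+1)%:R = k.+1%:R / #|S|%:R :> R by [].
  have := mul_bin_diag #|S| k; rewrite Sx /= => E.
  have c0 : (0 < 'C(#|S :\ x|.+1, k.+1))%N by rewrite bin_gt0; lia.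
  apply/eqP; rewrite eqr_div ?pnatr_eq0 -?lt0n // -!natrM eqr_nat mulnC; exact/eqP.
- have -> : avg ((fun A => x |: A) @: slice_of (S :\ x) k) X
      = avg (slice_of (S :\ x) k) (fun A => X (x |: A)).
    by rewrite /avg big_imset // card_in_imset.
  (* Coupling by inclusion: for [A = y |: B], the sets [y |: B] and [x |: B] differ by one
     exchange. *)
  rewrite -[in slice_of _ k.+1]addn1; apply: avg_dist_slice; first lia.
  move=> A B; rewrite !inE !finset.subsetD1 => /andP[/andP[AS xA] /eqP Ac].
  move=> /andP[/andP[BS xB] /eqP Bc] BA.
  have /cards1P[y yE] : #|A :\: B| == 1%N.
    by rewrite finset.cardsD (finset.setIidPr BA) Ac Bc; apply/eqP; lia.
  have yAB : y \in A :\: B by rewrite yE inE.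
  have -> : A = y |: B.
    by rewrite -yE -{1}(finset.setID A B) (finset.setIidPr BA) finset.setUC.
  move: yAB; rewrite inE => /andP[yB yA].
  apply: HX; rewrite ?Bc // !inE ?xB ?yB //=.
  exact: (fintype.subsetP AS).
- exact/subgaussian_on_imset.
Qed.

(** Induction on [#|S|]: every revealed element adds at most 1, and the slices of a one-element set
    are trivial, whence the predecessor. *)
Lemma subgaussian_on_slice S k X :
  swap_lipschitz S k X -> subgaussian_on (slice_of S k) X #|S|.-1%:R.
Proof.
have [n] := ubnP #|S|; elim: n S k X => // n IH S k X Sn HX.
have [kS|] := boolP ((k == 0%N) || (#|S| <= k)%N).
  exact: subgaussian_on_slice_trivial.
rewrite negb_or -lt0n -ltnNge => /andP[k0 kS].
case: k k0 kS HX => // k _ kS HX.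
have /card_gt0P[x xS] : (0 < #|S|)%N by lia.
have Sx : #|S| = #|S :\ x|.+1 by rewrite (cardsD1 x) xS.
have [|kappa [ka0 ka1 _ kaP]] := @two_point_subgaussian R (k.+1%:R / #|S|%:R).
  by rewrite divr_ge0 //= ler_pdivrMr ?mul1r ?ler_nat ?ltr0n; lia.
apply: (@subgaussian_on_le _ _ _ _ (#|S :\ x|.-1%:R + kappa)).
  rewrite (_ : #|S|.-1 = #|S :\ x|.-1.+1); last by lia.
  by rewrite -natr1 lerD2l.
apply: (subgaussian_on_slice_step xS) => //; apply: IH; try lia.
  exact: swap_lipschitz_out.
exact: swap_lipschitz_in.
Qed.

(** Outside the trivial levels, the first step has probability [k / #|S|], different from 1/2, and
    so costs less than 1. The choice of [s] precedes [X], which makes the gain uniform. *)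
Lemma subgaussian_on_slice_asym S k : (1 < #|S|)%N -> (k.*2 != #|S|)%N ->
  exists s, [/\ 0 <= s, s < #|S|.-1%:R &
    forall X, swap_lipschitz S k X -> subgaussian_on (slice_of S k) X s].
Proof.
move=> S1 kS2.
have [kS|] := boolP ((k == 0%N) || (#|S| <= k)%N).
  exists 0; split => //; first by rewrite ltr0n; lia.
  by move=> X _; exact: subgaussian_on_slice_trivial.
rewrite negb_or -lt0n -ltnNge => /andP[k0 kS].
case: k k0 kS kS2 => // k _ kS kS2.
have /card_gt0P[x xS] : (0 < #|S|)%N by lia.
have Sx : #|S| = #|S :\ x|.+1 by rewrite (cardsD1 x) xS.
have [|kappa [ka0 ka1 ka2 kaP]] := @two_point_subgaussian R (k.+1%:R / #|S|%:R).
  by rewrite divr_ge0 //= ler_pdivrMr ?mul1r ?ler_nat ?ltr0n; lia.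
exists (#|S :\ x|.-1%:R + kappa); split; first by rewrite addr_ge0.
- rewrite (_ : #|S|.-1 = #|S :\ x|.-1.+1); last by lia.
  rewrite -natr1 ltrD2l ka2 //; apply: contra kS2.
  rewrite -[X in _ == X]mul1r eqr_div ?pnatr_eq0 //; last by lia.
  by rewrite mul1r -natrM eqr_nat muln2.
- move=> X HX; apply: (subgaussian_on_slice_step xS) => //; apply: subgaussian_on_slice.
    exact: swap_lipschitz_out.
  exact: swap_lipschitz_in.
Qed.

(* For [k = #|S| / 2] the first step is symmetric, but the second one is not. *)
Lemma subgaussian_on_slice_lt S k : (2 < #|S|)%N ->
  exists s, [/\ 0 <= s, s < #|S|.-1%:R &
    forall X, swap_lipschitz S k X -> subgaussian_on (slice_of S k) X s].
Proof.
move=> S2; have [kS|] := eqVneq k.*2 #|S|; last by apply: subgaussian_on_slice_asym; lia.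
case: k kS => [|k kS]; first by lia.
have /card_gt0P[x xS] : (0 < #|S|)%N by lia.
have Sx : #|S| = #|S :\ x|.+1 by rewrite (cardsD1 x) xS.
(* Now [#|S :\ x|] is odd, so neither [k.+1] nor [k] is half of it. *)
have [||s1 [s10 s1S H1]] := @subgaussian_on_slice_asym (S :\ x) k.+1; try lia.
have [||s2 [s20 s2S H2]] := @subgaussian_on_slice_asym (S :\ x) k; try lia.
have [|kappa [ka0 ka1 _ kaP]] := @two_point_subgaussian R (k.+1%:R / #|S|%:R).
  by rewrite divr_ge0 //= ler_pdivrMr ?mul1r ?ler_nat ?ltr0n; lia.
exists (Num.max s1 s2 + kappa); split.
- by rewrite addr_ge0 // le_max s10.
- rewrite (_ : #|S|.-1 = #|S :\ x|.-1.+1); last by lia.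
  by rewrite -natr1 ltr_leD // gt_max s1S.
- move=> X HX; apply: (subgaussian_on_slice_step xS) => //; first by lia.
    apply: subgaussian_on_le (H1 _ _); first by rewrite le_max lexx.
    exact: swap_lipschitz_out.
  apply: subgaussian_on_le (H2 _ _); first by rewrite le_max lexx orbT.
  exact: swap_lipschitz_in.
Qed.

End Slice.

(** * Passage to the Hamming space *)

Section HammingSlices.
Variables (R : realType) (n : nat).

Lemma slices2E a b :
  slices n [:: a; b] = slice_of [set: 'I_n]%SET a :|: slice_of [set: 'I_n]%SET b.
Proof.
rewrite /slices !big_cons big_nil finset.setU0.
by apply/setP => A; rewrite !inE !finset.subsetT.
Qed.

(** A function on all subsets can be restricted to each slice; the default 0 off [F] does not enter
    averages over [F]. *)
Definition extend (F : {set {set 'I_n}}) (X : {A | A \in F} -> R) (A : {set 'I_n}) : R :=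
  if insub A is Some u then X u else 0.

Lemma unif_meanE (F : {set {set 'I_n}}) (X : {set 'I_n} -> R) :
  unif_mean (fun u : {A | A \in F} => X (val u)) = avg F X.
Proof.
have valF : [set val u | u in [set: {A | A \in F}]]%SET = F.
  apply/setP => A; apply/imsetP/idP => [[u _ ->]|AF]; first exact: valP.
  by exists (Sub A AF); rewrite ?inE ?SubK.
rewrite /unif_mean /avg -[in RHS]valF big_imset /=; last first.
  by move=> u v _ _; exact: val_inj.
rewrite card_imset ?cardsT; last exact: val_inj.
by congr (_ / _); apply: eq_bigl => u; rewrite inE.
Qed.

Lemma subgaussian_bound_extend (F : {set {set 'I_n}}) (X : {A | A \in F} -> R) s :
  0 <= s -> subgaussian_on F (extend X) s -> subgaussian_bound X s.
Proof.
move=> s0 H; have XE : X = (fun u => extend X (val u)).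
  by apply/funext => u; rewrite /extend valK.
split=> // t; rewrite XE unif_meanE -/(extend X).
by rewrite (unif_meanE F (fun A => expR (t * (extend X A - avg F (extend X))))); exact: H.
Qed.

Lemma lipschitz1_extend (F : {set {set 'I_n}}) (X : hamming_space R F -> R) :
  lipschitz1 X -> forall A B, A \in F -> B \in F ->
  `|extend X A - extend X B| <= #|symdiff A B|%:R.
Proof.
move=> HX A B AF BF; rewrite /extend !insubT.
exact: HX.
Qed.

(** [y |: B] and [z |: B] can differ only in [y] and [z]. *)
Lemma lipschitz1_swap (F : {set {set 'I_n}}) (X : hamming_space R F -> R) k :
  slice_of [set: 'I_n]%SET k \subset F -> lipschitz1 X ->
  swap_lipschitz [set: 'I_n]%SET k (extend X).
Proof.
move=> /fintype.subsetP kF HX B y z _ Bk; rewrite !inE !andbT => yB zB.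
apply: le_trans (lipschitz1_extend HX _ _) _.
- by apply: kF; rewrite inE finset.subsetT cardsU1 yB -Bk /=.
- by apply: kF; rewrite inE finset.subsetT cardsU1 zB -Bk /=.
rewrite ler_nat; apply: leq_trans (_ : #|[set y; z]%SET| <= _)%N; last first.
  by rewrite cards2; case: eqP.
apply/subset_leq_card/fintype.subsetP => i; rewrite !inE.
by case: (i \in B); case: eqP; case: eqP.
Qed.

End HammingSlices.

(** * Mixing the two levels *)

Theorem theorem2p5 (R : realType) (n r : nat) (hn : (3 <= n)%N)
    (hrn : (r <= n)%N) (hpar : r = n %[mod 2]) :
  (subgaussian_const
     (hamming_space R (slices n [:: ((n - r) %/ 2)%N; ((n + r) %/ 2)%N]))
   < (n%:R - 1 + r%:R ^+ 2 / 4)%:E)%E.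
Proof.
set a := ((n - r) %/ 2)%N.
have -> : ((n + r) %/ 2)%N = (a + r)%N by rewrite /a; lia.
(* By parity the two levels are complementary, hence equally large. *)
have na : (n - a = a + r)%N by rewrite /a; lia.
have an : (a + r <= n)%N by rewrite /a; lia.
clearbody a; have {hpar} a_le := leq_trans (leq_addr r a) an.
set F := slices _ _; pose S := [set: 'I_n]%SET.
have cS : #|S| = n by rewrite cardsT card_ord.
have S2 : (2 < #|S|)%N by rewrite cS.
have FE : F = slice_of S a :|: slice_of S (a + r) by exact: slices2E.
have [s1 [s10 s1n H1]] := @subgaussian_on_slice_lt R _ S a S2.
have [s2 [s20 s2n H2]] := @subgaussian_on_slice_lt R _ S (a + r)%N S2.
pose s := Num.max s1 s2.
have s0 : 0 <= s by rewrite le_max s10.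
have sn : s < n%:R - 1.
  have -> : n%:R - 1 = #|S|.-1%:R :> R.
    by rewrite cS -[in LHS](@prednK n) ?(ltn_trans _ hn) // -natr1 addrK.
  by rewrite gt_max s1n.
have r0 : 0 <= r%:R ^+ 2 / 4 :> R by rewrite divr_ge0 // sqr_ge0.
(* A supremum preserves only non-strict bounds; strictness survives because [s] does not depend on
   [X]. *)
apply: (@le_lt_trans _ _ (s + r%:R ^+ 2 / 4)%:E); last by rewrite lte_fin ltrD2r.
apply: ub_ereal_sup => _ [X /= HX <-].
apply: ereal_inf_lbound; exists (s + r%:R ^+ 2 / 4) => //=.
apply: subgaussian_bound_extend; first by rewrite addr_ge0.
have XL := lipschitz1_extend HX; have XS k := @lipschitz1_swap R n F X k ^~ HX.
move: (extend X) XL XS => Y YL YS.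
have sgD : subgaussian_on (slice_of S a) Y s.
  apply: subgaussian_on_le (H1 _ _); first by rewrite le_max lexx.
  by apply: YS; rewrite FE finset.subsetUl.
have sgE : subgaussian_on (slice_of S (a + r)) Y s.
  apply: subgaussian_on_le (H2 _ _); first by rewrite le_max lexx orbT.
  by apply: YS; rewrite FE finset.subsetUr.
(* For [r = 0] the levels coincide and the union is not a disjoint mixture. *)
rewrite FE; have [r_eq0|r_gt0] := posnP r.
  rewrite r_eq0 addn0 finset.setUid.
  by apply: subgaussian_on_le sgD; rewrite -r_eq0 lerDl.
(* Equal sizes give the mixture weight 1/2. *)
have [|kappa [ka0 ka1 _ kaP]] := @two_point_subgaussian R 2^-1; first lra.
apply: (@subgaussian_on_le _ _ _ _ (s + kappa * r%:R ^+ 2 / 4)); first by nra.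
have dis : [disjoint slice_of S a & slice_of S (a + r)].
  rewrite -finset.setI_eq0; apply/eqP/setP => A; rewrite !inE.
  apply/negP => /andP[/andP[_ /eqP ->]]; rewrite -{1}[a]addn0 eqn_add2l eq_sym.
  by rewrite eqn0Ngt r_gt0 andbF.
have cE : #|slice_of S (a + r)| = #|slice_of S a|.
  by rewrite !cards_draws cS -na bin_sub.
have cD : (0 < #|slice_of S a|)%N by rewrite cards_draws bin_gt0 cS.
apply: subgaussian_on_setU => //; first by rewrite cE.
  rewrite finset.cardsU finset.disjoint_setI0 // cards0 subn0 cE natrD.
  rewrite (_ : _ / _ = 2^-1) //; field.
  by rewrite -natrD pnatr_eq0 addn_eq0 negb_and -lt0n cD.
(* Nested sets from the two levels are at distance exactly [r]. *)
rewrite distrC; apply: avg_dist_slice; first by rewrite cS.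
move=> A B AE BD BA.
apply: le_trans (YL _ _ _ _) _.
- by rewrite FE inE AE orbT.
- by rewrite FE inE BD.
move: AE BD; rewrite !inE => /andP[_ /eqP Ac] /andP[_ /eqP Bc].
rewrite /symdiff (eqP (_ : B :\: A == finset.set0)) ?finset.setD_eq0 // finset.setU0.
by rewrite finset.cardsD (finset.setIidPr BA) Ac Bc addKn.
Qed.
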